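(* Let $n\ge 3$ be an integer and let $r$ be an integer with $1\le r\le \max\left(1,\lfloor \frac{n}{4}\rfloor-1\right)$. Then $BS(1,n)$ has a positive density of elements $g$ with $\kappa_r(g)=0$; that is, there is a set $\mathcal{A}\subset BS(1,n)$ of positive density in $BS(1,n)$ such that $\kappa_r(g)=0$ for every $g\in\mathcal{A}$.
   Context: $BS(1,n)=\langle t,a \mid tat^{-1}=a^n\rangle$. Word length $l(\cdot)$ is always with respect to the generating set $\{a,t\}$ (i.e. letters $a^{\pm1},t^{\pm1}$). $S_n(r)$ denotes the sphere of radius $r$ centered at the identity in $BS(1,n)$, i.e. the set of elements of word length exactly $r$. For $g\ne e$ and an integer $r\ge 1$, the conjugation curvature is $$\kappa_r(g)=\frac{l(g)-\frac{1}{|S_n(r)|}\sum_{p\in S_n(r)} l(p^{-1}gp)}{l(g)}.$$ For $\mathcal{A}\subset BS(1,n)$ let $\mathcal{A}(N)$ be the set of elements of $\mathcal{A}$ of word length $N$. The set $\mathcal{A}$ has positive density in $BS(1,n)$ if there is $\epsilon>0$ such that for all sufficiently large $N$, $\epsilon<\frac{|\mathcal{A}(N)|}{|S_n(N)|}<1-\epsilon$. *)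

(* Defs.v *)
From HB Require Import structures.
From mathcomp Require Import all_boot all_order all_algebra.
From mathcomp Require Import finmap all_classical all_reals.

Set Implicit Arguments.
Unset Strict Implicit.
Unset Printing Implicit Defensive.
Import Order.TTheory GRing.Theory Num.Theory.

Local Open Scope classical_set_scope.
Local Open Scope quotient_scope.

Inductive bs_gen := gen_a | gen_t.

Definition bool_of_gen (g : bs_gen) := if g is gen_a then true else false.
Definition gen_of_bool (b : bool) := if b then gen_a else gen_t.
Lemma bool_of_genK : cancel bool_of_gen gen_of_bool. Proof. by case. Qed.

HB.instance Definition _ := Countable.copy bs_gen (can_type bool_of_genK).

(* The letter (g, false) stands for g and (g, true) for g^-1. *)
Definition letter : Type := bs_gen * bool.
HB.instance Definition _ := Countable.on letter.

Definition inv_letter (x : letter) : letter := (x.1, ~~ x.2).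

Definition word : Type := seq letter.
HB.instance Definition _ := Countable.on word.

(* Equality of words in < t, a | t a t^-1 = a^n >: the least congruence on the
   free monoid containing free cancellation and the defining relation. *)
Inductive bs_eq (n : nat) : word -> word -> Prop :=
| bs_eq_refl u : bs_eq n u u
| bs_eq_sym u v : bs_eq n u v -> bs_eq n v u
| bs_eq_trans u v w : bs_eq n u v -> bs_eq n v w -> bs_eq n u w
| bs_eq_cat u u' v v' :
    bs_eq n u u' -> bs_eq n v v' -> bs_eq n (u ++ v) (u' ++ v')
| bs_eq_free x : bs_eq n [:: x; inv_letter x] [::]
| bs_eq_rel :
    bs_eq n [:: (gen_t, false); (gen_a, false); (gen_t, true)]
            (nseq n (gen_a, false)).

Definition bs_eqb (n : nat) : rel word := fun u v => `[< bs_eq n u v >].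

Lemma bs_eqb_refl n : reflexive (bs_eqb n).
Proof. by move=> u; apply/asboolP; exact: bs_eq_refl. Qed.

Lemma bs_eqb_sym n : symmetric (bs_eqb n).
Proof. by move=> u v; apply/asboolP/asboolP; exact: bs_eq_sym. Qed.

Lemma bs_eqb_trans n : transitive (bs_eqb n).
Proof.
by move=> v u w /asboolP uv /asboolP vw; apply/asboolP; exact: bs_eq_trans vw.
Qed.

Canonical bs_equiv n :=
  EquivRel (bs_eqb n) (bs_eqb_refl n) (bs_eqb_sym n) (@bs_eqb_trans n).

Definition BS (n : nat) : Type := {eq_quot (bs_equiv n)}.
HB.instance Definition _ n := Choice.on (BS n).
HB.instance Definition _ n := EqQuotient.on (BS n).

Lemma bs_piP n (u v : word) : (\pi_(BS n) u = \pi_(BS n) v) <-> bs_eq n u v.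
Proof.
by split=> [/eqquotP/asboolP | uv] //; apply/eqquotP/asboolP.
Qed.

Definition inv_word (w : word) : word := rev (map inv_letter w).

Lemma inv_letterK : involutive inv_letter.
Proof. by case=> g b; rewrite /inv_letter /= negbK. Qed.

Lemma inv_wordK : involutive inv_word.
Proof.
move=> w; rewrite /inv_word map_rev revK -map_comp -[RHS]map_id.
by apply: eq_map => x /=; rewrite inv_letterK.
Qed.

Lemma inv_word_cat u v : inv_word (u ++ v) = inv_word v ++ inv_word u.
Proof. by rewrite /inv_word map_cat rev_cat. Qed.

Lemma bs_eq_wordV n w : bs_eq n (w ++ inv_word w) [::].
Proof.
elim: w => [|x w IH]; first exact: bs_eq_refl.
rewrite -[x :: w]/([:: x] ++ w) inv_word_cat -catA [w ++ _]catA.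
apply: bs_eq_trans (bs_eq_free n x).
rewrite -[[:: x; _]]/([:: x] ++ [::] ++ inv_word [:: x]).
by do 2! [apply: bs_eq_cat => //; try exact: bs_eq_refl].
Qed.

Lemma bs_eq_Vword n w : bs_eq n (inv_word w ++ w) [::].
Proof. by rewrite -{2}[w]inv_wordK; exact: bs_eq_wordV. Qed.

Lemma bs_eq_inv n u v : bs_eq n u v -> bs_eq n (inv_word u) (inv_word v).
Proof.
move=> uv; apply: (@bs_eq_trans _ _ (inv_word u ++ (v ++ inv_word v))).
  rewrite -{1}[inv_word u]cats0; apply: bs_eq_cat; first exact: bs_eq_refl.
  by apply: bs_eq_sym; exact: bs_eq_wordV.
rewrite catA -{2}[inv_word v]cat0s; apply: bs_eq_cat; last exact: bs_eq_refl.
apply: bs_eq_trans (bs_eq_Vword n u).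
by apply: bs_eq_cat; [exact: bs_eq_refl | exact: bs_eq_sym].
Qed.

Definition bs_one n : BS n := \pi_(BS n) [::].
Definition bs_inv n (x : BS n) : BS n := \pi_(BS n) (inv_word (repr x)).
Definition bs_mul n (x y : BS n) : BS n := \pi_(BS n) (repr x ++ repr y).

Lemma bs_repr_pi n (u : word) : bs_eq n (repr (\pi_(BS n) u)) u.
Proof. by apply/bs_piP; rewrite reprK. Qed.

Lemma bs_mul_pi n (u v : word) :
  bs_mul (\pi_(BS n) u) (\pi_(BS n) v) = \pi_(BS n) (u ++ v).
Proof. by apply/bs_piP; apply: bs_eq_cat; exact: bs_repr_pi. Qed.

Lemma bs_inv_pi n (u : word) :
  bs_inv (\pi_(BS n) u) = \pi_(BS n) (inv_word u).
Proof. by apply/bs_piP; apply: bs_eq_inv; exact: bs_repr_pi. Qed.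

Lemma bs_ind n (P : BS n -> Prop) : (forall w, P (\pi_(BS n) w)) -> forall x, P x.
Proof. by move=> H x; rewrite -[x]reprK. Qed.

Lemma bs_mulA n : associative (@bs_mul n).
Proof.
elim/bs_ind=> u; elim/bs_ind=> v; elim/bs_ind=> w.
by rewrite !bs_mul_pi catA.
Qed.

Lemma bs_mul1 n : left_id (bs_one n) (@bs_mul n).
Proof. by elim/bs_ind=> u; rewrite bs_mul_pi. Qed.

Lemma bs_mulr1 n : right_id (bs_one n) (@bs_mul n).
Proof. by elim/bs_ind=> u; rewrite bs_mul_pi cats0. Qed.

Lemma bs_mulV n : left_inverse (bs_one n) (@bs_inv n) (@bs_mul n).
Proof.
by elim/bs_ind=> u; rewrite bs_inv_pi bs_mul_pi; apply/bs_piP/bs_eq_Vword.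
Qed.

Lemma bs_mulrV n : right_inverse (bs_one n) (@bs_inv n) (@bs_mul n).
Proof.
by elim/bs_ind=> u; rewrite bs_inv_pi bs_mul_pi; apply/bs_piP/bs_eq_wordV.
Qed.

HB.instance Definition _ n := isGroup.Build (BS n)
  (@bs_mulA n) (@bs_mul1 n) (@bs_mulr1 n) (@bs_mulV n) (@bs_mulrV n).

Definition bs_a n : BS n := \pi_(BS n) [:: (gen_a, false)].
Definition bs_t n : BS n := \pi_(BS n) [:: (gen_t, false)].

Lemma bs_relation n : (bs_t n * bs_a n * (bs_t n)^-1 = bs_a n ^+ n)%g.
Proof.
have aX k : (bs_a n ^+ k)%g = \pi_(BS n) (nseq k (gen_a, false)).
  elim: k => [|k IH]; first by rewrite expg0.
  by rewrite expgS IH; apply: bs_mul_pi.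
rewrite aX /bs_t /bs_a; have mulE (x y : BS n) : (x * y)%g = bs_mul x y by [].
have -> : ((\pi_(BS n) [:: (gen_t, false)] : BS n)^-1)%g = bs_inv (\pi_(BS n) [:: (gen_t, false)]) by [].
rewrite !mulE bs_inv_pi (bs_mul_pi n _ [:: (gen_a, false)]) bs_mul_pi.
by apply/bs_piP; exact: bs_eq_rel.
Qed.

Lemma bs_universal n (G : groupType) (x y : G) : (y * x * y^-1 = x ^+ n)%g ->
  exists f : BS n -> G,
    [/\ {morph f : g h / (g * h)%g}, f (bs_a n) = x & f (bs_t n) = y].
Proof.
move=> xy; pose lv (l : letter) : G :=
  let g := if l.1 is gen_a then x else y in if l.2 then (g^-1)%g else g.
pose wv (w : word) : G := (\prod_(l <- w) lv l)%g.
have wv_eq u v : bs_eq n u v -> wv u = wv v.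
  elim=> {u v} //.
  - by move=> u v w _ -> _ ->.
  - by move=> u u' v v' _ uu' _ vv'; rewrite /wv !big_cat /= -!/(wv _) uu' vv'.
  - case=> [g b]; rewrite /wv !big_cons big_nil mulg1 /lv /=.
    by case: b; rewrite /= ?mulVg ?mulgV.
  - rewrite /wv !big_cons big_nil mulg1 mulgA /lv /= xy.
    elim: {1 2}n => [|k IH]; first by rewrite big_nil expg0.
    by rewrite expgS big_cons /= -IH.
exists (fun g => wv (repr g)); split.
- elim/bs_ind=> u; elim/bs_ind=> v.
  rewrite -[RHS]/(wv _ * wv _)%g /wv -big_cat -!/(wv _).
  by apply: wv_eq; exact: bs_repr_pi.
- by rewrite (wv_eq _ _ (bs_repr_pi n _)) /wv big_seq1.
- by rewrite (wv_eq _ _ (bs_repr_pi n _)) /wv big_seq1.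
Qed.

Definition letter_val n (x : letter) : BS n :=
  let g := if x.1 is gen_a then bs_a n else bs_t n in
  if x.2 then (g^-1)%g else g.

Definition word_val n (w : word) : BS n := (\prod_(x <- w) letter_val n x)%g.

Lemma word_valE n w : word_val n w = \pi_(BS n) w.
Proof.
have letE x : letter_val n x = \pi_(BS n) [:: x].
  by case: x => [[] []]; rewrite /letter_val //=; apply: bs_inv_pi.
elim: w => [|x w IH]; first by rewrite /word_val big_nil.
by rewrite /word_val big_cons -/(word_val n w) IH letE; apply: bs_mul_pi.
Qed.

Lemma word_length_ex n (g : BS n) :
  exists k, `[< exists2 w : word, size w = k & word_val n w = g >].
Proof.
by exists (size (repr g)); apply/asboolP; exists (repr g); rewrite // word_valE reprK.
Qed.

Definition word_length n (g : BS n) : nat := ex_minn (word_length_ex g).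

Definition sphere n (r : nat) : set (BS n) := [set g | word_length g = r].
Arguments sphere n r : clear implicits.

Lemma sphere_finite n r : finite_set (sphere n r).
Proof.
have fT : finite_set [set` [seq word_val n (map (fun x => (gen_of_bool x.1, x.2)) w) |
                             w : r.-tuple (bool * bool)]].
  exact: finite_seq.
apply: sub_finite_set fT => g; rewrite /sphere /word_length /=.
case: ex_minnP => k /asboolP[w <- <-] _ wr.
have sw : size (map (fun x : letter => (bool_of_gen x.1, x.2)) w) == r.
  by rewrite size_map wr.
apply/mapP; exists (Tuple sw); first by rewrite mem_enum.
rewrite /= -map_comp; congr word_val; rewrite -[LHS]map_id.
by apply: eq_map => -[y b] /=; rewrite bool_of_genK.
Qed.

(* Cardinality of a finite set; only used for subsets of spheres, which are
   finite by sphere_finite. *)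
Definition card n (A : set (BS n)) : nat := #|` fset_set A|%fset.

Local Open Scope ring_scope.

(* Meaningful for g <> 1 only, since the value is a quotient by the length
   of g; (g ^ p)%g is p^-1 * g * p. *)
Definition conj_curvature (R : realType) n (r : nat) (g : BS n) : R :=
  let l (h : BS n) : R := (word_length h)%:R in
  (l g - (\sum_(p \in sphere n r) l (g ^ p)%g) / (card (sphere n r))%:R) / l g.

Definition positive_density (R : realType) n (A : set (BS n)) : Prop :=
  exists2 eps : R, 0 < eps &
    \forall N \near \oo,
      eps < (card (A `&` sphere n N))%:R / (card (sphere n N))%:R < 1 - eps.

(* Main.v *)
Require Import Defs.
From mathcomp Require Import all_boot all_order all_algebra.
From mathcomp Require Import all_classical all_reals.
From mathcomp Require Import finmap zify ring lra.

(** An element of [BS(1,n)] is a pair [(x, k)] with [x] in [Z[1/n]] and [k] in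
    [Z]. A word is a walk on the integers: [t] moves up one level, and a letter
    [a] read at level [i] adds [n ^ i] to [x]. So the length of [(x, k)] is the
    least value, over all ways of writing [x] as a sum of [d_i n ^ i], of the sum
    of the [|d_i|] plus the number of moves of a walk from 0 to [k] that visits
    all levels with [d_i <> 0]. For [k >= 0] a walk over [m] levels takes
    [2 (m - 1) - k] moves, wherever the levels 0 and [k] lie among them.

    Conjugating [(x, k)] by [p = (y, m)] gives [n ^ (- m) (x - y + n ^ k y)]: the
    digits move by [m] levels relative to the levels 0 and [k], those around
    level 0 decrease by the digits of [y], and those around level [k] increase by
    them. Suppose that all digits of [x] around levels 0 and [k] are equal to [r],
    that digits from 0 to [2 r] in these places are always optimal, and that the
    cheapest digit strings extend far below level 0 and far above level [k]. Then
    for [p] of length [r] the shift does not change the length, and one end of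
    the string gains exactly what the other loses. So every conjugate [g ^ p]
    has the length of [g], and the curvature is 0. These elements are called
    [good] below, and [conj_length] is this computation.

    The optimality is a statement on carries. Two strings with the same value and
    with digits less than [n] in absolute value differ by carries in [{-1, 0, 1}].
    At a zero digit a carry costs at least as much as it can save elsewhere, because
    [n >= 3], and inside a window of digits at most [2 r] a carry does not pay,
    because [r <= n / 4 - 1] or [r = 1]. Hence a window between two zeros can be
    exchanged for another one at exactly the difference of the costs
    ([swap_rigid]).

    For the density, every element of height [k >= 0] becomes good after
    multiplication on both sides by elements of bounded length, which overwrite
    the digits near levels 0 and [k] ([reach_good]); the length is then only
    approximately known. It is corrected by inserting zero levels next to a
    window, which increases the length by exactly one and is injective
    ([insert_level], [inserts_inj]). Together these bound the size of the sphere
    by a constant times the number of good elements in it ([sphere_le_good]).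
    On the other hand good elements have positive height, so inversion sends them
    to elements that are not good, and at most half of the sphere is good. *)

Set Implicit Arguments.
Unset Strict Implicit.
Unset Printing Implicit Defensive.
Import Order.TTheory GRing.Theory Num.Theory.
Local Open Scope classical_set_scope.
Local Open Scope quotient_scope.
Local Open Scope ring_scope.

(** * Digit strings, their values and their costs *)

Definition norm1 (s : seq int) : int := foldr (fun d v => `|d| + v) 0 s.

(** The price of the letters of a walk that climbs through all the levels of
    [s] and comes back, up to an additive constant: one letter per unit of a
    digit, two letters per level. *)
Definition cost (s : seq int) : int := norm1 s + 2 * (size s)%:Z.

Lemma norm1_cat s u : norm1 (s ++ u) = norm1 s + norm1 u.
Proof. by elim: s => [|d s IH] /=; rewrite ?IH; ring. Qed.

Lemma norm1_nseq0 k : norm1 (nseq k 0) = 0.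
Proof. by elim: k => //= k ->. Qed.

Lemma norm1_ge0 s : 0 <= norm1 s.
Proof. by elim: s => //= d s; lia. Qed.

Lemma cost_cat s u : cost (s ++ u) = cost s + cost u.
Proof. by rewrite /cost norm1_cat size_cat; lia. Qed.

Lemma cost_cons d s : cost (d :: s) = `|d| + 2 + cost s.
Proof. by rewrite /cost /=; lia. Qed.

Section Digits.
Variable b : int.
Implicit Types (A B L M S U s u : seq int) (c d e X : int).

(** Lowest digit first. *)
Definition eval s : int := foldr (fun d v => d + b * v) 0 s.

Definition bounded s : bool := all (fun d => `|d| < b) s.

Definition has_cost X c := exists2 s, eval s = X & cost s <= c.

Lemma eval_cat s u : eval (s ++ u) = eval s + b ^+ size s * eval u.
Proof. by elim: s => [|d s IH] /=; rewrite ?IH ?exprS; ring. Qed.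

Lemma eval_nseq0 k : eval (nseq k 0) = 0.
Proof. by elim: k => //= k ->; ring. Qed.

Lemma eval_shift c d u :
  eval [seq d + c * y | y <- u] = eval (nseq (size u) d) + c * eval u.
Proof. by elim: u => [|y u /= ->]; rewrite /= ?mulr0 //; ring. Qed.

Lemma eval_add_at z c s : (z < size s)%N ->
  exists s', [/\ size s' = size s, eval s' = eval s + c * b ^+ z
   & norm1 s' <= norm1 s + `|c|].
Proof.
elim: s z => [|d s IH] [|z] //= zs.
  by exists (d + c :: s); split => //=; [ring | lia].
have [s' [h1 h2 h3]] := IH z zs.
by exists (d :: s'); split; rewrite /= ?h1 ?h2 ?exprS //; [ring | lia].
Qed.

Lemma bounded_cat s u : bounded (s ++ u) = bounded s && bounded u.
Proof. exact: all_cat. Qed.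

Hypothesis b3 : 3 <= b.

Lemma bounded_nseq0 k : bounded (nseq k 0).
Proof. by rewrite /bounded all_nseq; apply/orP; right; lia. Qed.

Lemma norm1_bounded s : bounded s -> norm1 s <= b * (size s)%:Z.
Proof. by elim: s => [|d s IH] /=; [lia | case/andP=> ? /IH; lia]. Qed.

Lemma eval_bounded s : bounded s -> `|eval s| < b ^+ size s.
Proof.
elim: s => [|d s IH] //= /andP[ds /IH]; rewrite exprS.
move: (eval s) (b ^+ size s) => e p; nia.
Qed.

(** Rounding the quotient towards zero makes the remainder and the quotient share
    the sign of [c], so that their absolute values add up. *)
Lemma trunc_div c : exists q, [/\ `|c - b * q| < b & `|c - b * q| + b * `|q| = `|c|].
Proof.
have h k : exists q r : int, [/\ k = b * q + r, 0 <= r & r < b].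
  exists (k %/ b)%Z, (k %% b)%Z; have := divz_eq k b.
  have := ltz_pmod k (d := b); have := modz_ge0 k (d := b).
  have : b != 0 by lia.
  by move=> b0 /(_ b0) ? ? ->; split; lia.
case: (lerP 0 c) => c0.
  have [q [r [e1 r0 rb]]] := h c; exists q; have : 0 <= q by nia.
  by split; nia.
have [q [r [e1 r0 rb]]] := h (- c); exists (- q); have : 0 <= q by nia.
by split; nia.
Qed.

(** Splitting off [b] units of a digit [D] as one unit of the next digit saves
    [b - 1 >= 2] units, which pays for opening a new level. *)
Lemma normalize_int D : exists s, [/\ bounded s, eval s = D & cost s <= `|D| + 2].
Proof.
have [m] := ubnP `|D|%N; elim: m D => // m IH D Dm.
have [q [rb rq]] := trunc_div D.
have [q0|q0] := eqVneq q 0.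
  by exists [:: D]; rewrite /cost /= ; split; try lia; rewrite andbT; lia.
have [s [sb sq sc]] : exists s, [/\ bounded s, eval s = q & cost s <= `|q| + 2].
  by apply: IH; nia.
exists (D - b * q :: s); split; first by rewrite /= rb.
  by rewrite /= sq; ring.
by rewrite cost_cons; nia.
Qed.

Lemma normalize_carry s c :
  exists s', [/\ bounded s', eval s' = eval s + c
    & cost s' <= cost s + `|c| + (if s is [::] then 2 else 0)].
Proof.
elim: s c => [|d s IH] c.
  have [s [? ? sc]] := normalize_int c.
  by exists s; split; rewrite ?add0r //; apply: le_trans sc _; rewrite /cost /=; lia.
have [q [rb rq]] := trunc_div (d + c).
have [q0|q0] := eqVneq q 0.
  rewrite q0 mulr0 subr0 in rb rq.
  case: s IH => [|d1 s] IH.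
    exists [:: d + c]; split; rewrite /cost /=; try lia; rewrite andbT; lia.
  have [s' [sb es cs]] := IH 0.
  exists (d + c :: s'); split.
  - by rewrite /= rb.
  - by rewrite /= es /=; ring.
  - by move: cs; rewrite !cost_cons normr0; lia.
have [s' [? es cs]] := IH q.
exists (d + c - b * q :: s'); split.
- by rewrite /= rb.
- by rewrite /= es; ring.
- by rewrite !cost_cons; case: (s) cs => [|? ?] /= cs; nia.
Qed.

(** Cheapest strings may be assumed to have digits of absolute value less than
    [b]. This bounds all carries between two such strings by 1, which is what
    makes the comparison of costs below possible. *)
Lemma normalize X c : has_cost X c -> exists s, [/\ bounded s, eval s = X & cost s <= c].
Proof.
case=> -[|d s] sX sc; first by exists [::].
have [s' [? es ?]] := normalize_carry (d :: s) 0.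
by exists s'; split => //; [rewrite es; lia | lia].
Qed.

(** The lowest digit of a string for [b * X] is a multiple [b * q] of [b]; the
    carry [q] can be added to the next digit at no extra cost. *)
Lemma has_cost_divb X c : has_cost (b * X) c -> has_cost X c.
Proof.
case=> -[|d s] /= sX sc.
  by exists [::] => //=; nia.
have [q dq] : exists q, d = b * q by exists (X - eval s); lia.
subst d; case: s sX sc => [|d1 s] /= sX sc.
  exists [:: q]; rewrite /= ?mulr0 ?addr0; first by nia.
  by rewrite !cost_cons in sc *; nia.
exists (d1 + q :: s) => /=; first by nia.
by rewrite !cost_cons in sc *; nia.
Qed.

Lemma has_cost_divX X j c : has_cost (b ^+ j * X) c -> has_cost X c.
Proof.
elim: j => [|j IH]; first by rewrite mul1r.
by rewrite exprS -mulrA => /has_cost_divb.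
Qed.

(** * Carries between two strings of the same value *)

(** [carry c A A' e]: writing [A] as [A'] with a carry [c] coming in from the
    lower levels sends a carry [e] to the next higher level. *)
Fixpoint carry c A A' e : Prop :=
  match A, A' with
  | [::], [::] => c = e
  | d :: A1, d' :: A1' => exists2 c1, d + c = d' + b * c1 & carry c1 A1 A1' e
  | _, _ => False
  end.

Lemma carry_eval c A A' e :
  carry c A A' e -> eval A + c = eval A' + b ^+ size A' * e.
Proof.
elim: A A' c => [|d A IH] [|d' A'] c //=; first by move=> ->; ring.
by case=> c1 dc /IH; rewrite exprS => h; nia.
Qed.

Lemma carry_exists A A' u u' c : size A = size A' ->
  eval (A ++ u) + c = eval (A' ++ u') ->
  exists2 e, carry c A A' e & eval u + e = eval u'.
Proof.
elim: A A' c => [|d A IH] [|d' A'] c //=; first by exists c.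
case=> /IH {}IH h.
have [c1 dc] : exists c1, d + c = d' + b * c1.
  by exists (eval (A' ++ u') - eval (A ++ u)); lia.
have /IH[e ? ?] : eval (A ++ u) + c1 = eval (A' ++ u') by nia.
by exists e => //; exists c1.
Qed.

Lemma carry_step_small d d' c c1 : `|d| < b -> `|d'| < b -> `|c| <= 1 ->
  d + c = d' + b * c1 -> `|c1| <= 1.
Proof. by move=> *; nia. Qed.

Lemma carry_small A A' c e : bounded A -> bounded A' -> `|c| <= 1 ->
  carry c A A' e -> `|e| <= 1.
Proof.
elim: A A' c => [|d A IH] [|d' A'] c //=; first by move=> _ _ ? <-.
case/andP=> dA AA /andP[dA' AA'] c1 [c2 h] /IH; apply => //.
exact: carry_step_small h.
Qed.

(** A rigid block cannot be rewritten cheaply: a carry entering or leaving it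
    costs at least one extra unit. A block placed between other digits can
    therefore be cut out of any string that represents the same number,
    because the two carries at its ends can be repaired at that price. *)
Definition rigid B := forall B' c e, bounded B' -> `|c| <= 1 -> carry c B B' e ->
  norm1 B + `|c| + `|e| <= norm1 B'.

(** A weaker property, which becomes rigidity between two zero digits. *)
Definition subrigid B := forall B' c e, bounded B' -> `|c| <= 1 -> carry c B B' e ->
  norm1 B - `|c| - `|e| <= norm1 B'.

(** A zero digit absorbs carries: as [|c|] and [|e|] are at most 1 and [b >= 3],
    the digit [c - b * e] has absolute value at least [|c| + |e|]. *)
Lemma rigid_nseq0 k : rigid (nseq k.+1 0).
Proof.
move=> B'; elim: k B' => [|k IH] [|d' B'] c e //=.
  case: B' => [|? ?]; last by move=> _ _ [].
  move=> /andP[db _] c1 [c2 h <-] /=.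
  suff : `|c| + `|c2| <= `|d'| by lia.
  have := carry_step_small _ db c1 h; have : d' = c - b * c2 by lia.
  move=> -> ?; have [->|] := eqVneq c2 0; last by nia.
  lia.
case/andP=> db bB c1 [c2 h] cB.
have c2s : `|c2| <= 1 by apply: carry_step_small h => //; lia.
have := IH _ _ _ bB c2s cB; rewrite /= norm1_nseq0.
have -> : d' = c - b * c2 by lia.
have [->|] := eqVneq c2 0; nia.
Qed.

Lemma rigid_flank W : bounded W -> subrigid W -> rigid (0 :: W ++ [:: 0]).
Proof.
move=> Wb Wr [|d B'] c e //= /andP[db Bb] cs [c1 h].
have c1s : `|c1| <= 1 by apply: carry_step_small h => //; lia.
have r0 : rigid [:: 0] by exact: rigid_nseq0 0.
have k1 : `|c| + `|c1| <= `|d|.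
  by have := r0 [:: d] c c1; rewrite /= db; move/(_ isT cs (ex_intro2 _ _ _ h erefl)); lia.
(* Split off the last step of the carry chain, which crosses the upper zero. *)
have aux W1 B1 x : carry x (W1 ++ [:: 0]) B1 e ->
    exists W' d' y, [/\ B1 = W' ++ [:: d'], carry x W1 W' y & 0 + y = d' + b * e].
  elim: W1 B1 x => [|w W1 IH] [|d1 B1] x //=.
    case: B1 => [|? ?]; last by case.
    by case=> y hy <-; exists [::], d1, x.
  case=> y hy /IH[W' [d' [y' [-> ? ?]]]].
  by exists (d1 :: W'), d', y'; split => //; exists y.
case/aux => W' [d' [y [? cW hy]]]; subst B'.
move: Bb; rewrite bounded_cat /= => /and3P[bW' bd' _].
have ys : `|y| <= 1 by exact: carry_small cW.
have k2 : `|y| + `|e| <= `|d'|.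
  by have := r0 [:: d'] y e; rewrite /= bd'; move/(_ isT ys (ex_intro2 _ _ _ hy erefl)); lia.
have := Wr _ _ _ bW' c1s cW; rewrite !norm1_cat /=; lia.
Qed.

(** Sending a carry turns [d] into [d - b], and [b - d >= d - 1]. *)
Lemma subrigid1 d : 0 <= d -> 2 * d <= b + 1 -> subrigid [:: d].
Proof.
move=> d0 d2 [|d' [|? ?]] c e //=; last by move=> _ _ [].
move=> /andP[db _] cs [c1 h ce]; subst c1.
have es : `|e| <= 1 by apply: carry_step_small h => //; lia.
have -> : d' = d + c - b * e by lia.
have [->|] := eqVneq e 0; nia.
Qed.

(** Here [b - d >= d + 1]: an outgoing carry even costs a unit, which pays for its
    effect on the next digit. So the estimate passes along adjacent digits. *)
Lemma subrigid_small W : all (fun d => (0 <= d) && (2 * d + 1 <= b)) W -> subrigid W.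
Proof.
move=> Wd; suff h : forall B' c e, bounded B' -> `|c| <= 1 -> carry c W B' e ->
  norm1 W - `|c| + `|e| <= norm1 B'.
  by move=> B' c e ? ? /h; lia.
elim: W Wd => [|d W IH] /=; first by move=> _ [|//] c e /= _ _ ->; lia.
case/andP=> /andP[d0 d2] /IH {}IH [|d' B'] c e //= /andP[db Bb] cs [c1 h cW].
have c1s : `|c1| <= 1 by apply: carry_step_small h => //; lia.
have := IH _ _ _ Bb c1s cW.
have -> : d' = d + c - b * c1 by lia.
have [->|] := eqVneq c1 0; nia.
Qed.

Lemma eval_ge2 s u : bounded s -> 2 <= `|eval u| -> 2 <= `|eval (s ++ u)|.
Proof.
move=> sb u2; elim: s sb => //= d s IH /andP[db /IH]; nia.
Qed.

(** If the upper part has a value of absolute value at least 2, it cannot be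
    replaced by a mere carry, so that every bounded string of the same value
    reaches above the lower part. *)
Lemma size_gt_prefix A u s : bounded A -> 2 <= `|eval u| -> bounded s ->
  eval s = eval (A ++ u) -> (size A < size s)%N.
Proof.
move=> Ab u2 sb es; rewrite ltnNge; apply/negP=> sA.
pose s' := s ++ nseq (size A - size s) 0.
have es' : eval (A ++ u) + 0 = eval (s' ++ [::]).
  by rewrite cats0 /s' [RHS]eval_cat eval_nseq0 -es; ring.
have [|e ce] := carry_exists _ es'; first by rewrite size_cat size_nseq; lia.
have : `|e| <= 1.
  by apply: carry_small ce => //; rewrite bounded_cat sb bounded_nseq0.
by rewrite /=; lia.
Qed.

(** The comparison principle behind all length computations: a rigid block [B]
    of a number can be exchanged for any block [B0], and the least cost grows by
    at most the difference of the costs of the blocks. When [B0] is rigid too,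
    the exchange can be undone and the least cost changes by exactly this
    difference. *)
Lemma swap_rigid L B B0 U c : bounded L -> bounded B -> rigid B -> (0 < size B0)%N ->
  2 <= `|eval U| ->
  has_cost (eval (L ++ B ++ U)) c -> has_cost (eval (L ++ B0 ++ U)) (c + cost B0 - cost B).
Proof.
move=> Lb Bb Br; case: B0 => // d0 B0 _ U2 /normalize[s [sb es sc]].
have ssz : (size (L ++ B) < size s)%N.
  by apply: (@size_gt_prefix _ U); rewrite ?bounded_cat ?Lb // -catA.
rewrite size_cat in ssz.
pose L' := take (size L) s; pose s1 := drop (size L) s.
pose B' := take (size B) s1; pose U' := drop (size B) s1.
have ds : s = L' ++ B' ++ U' by rewrite !cat_take_drop.
have sL : size L' = size L by rewrite size_take; case: ltnP; lia.
have sB : size B' = size B by rewrite size_take /s1 size_drop; case: ltnP; lia.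
have : (0 < size U')%N by rewrite !size_drop; lia.
clearbody L' B' U'; clear s1.
case: U' ds => // d1 U' ds _; subst s.
move: sb; rewrite !bounded_cat => /and3P[bL' bB' _].
have [|e1 c1 h1] := @carry_exists L L' (B ++ U) (B' ++ d1 :: U') 0 (esym sL).
  by rewrite es; ring.
have [|e2 c2 h2] := @carry_exists B B' U (d1 :: U') e1 (esym sB) => //.
have e1s : `|e1| <= 1 by apply: carry_small c1.
have := Br _ _ _ bB' e1s c2.
have := carry_eval c1; have := carry_eval c2 => k2 k1 nB.
(* The carry into [B] is left in the lowest digit of [B0], the carry out of [B] is
   taken back from the digit above: this costs at most the [|e1| + |e2|] that
   rigidity saves. *)
exists (L' ++ (d0 + e1 :: B0) ++ (d1 - e2 :: U')).
  have hU : eval (d1 - e2 :: U') = eval U by rewrite /= in h2 *; lia.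
  rewrite !eval_cat hU sL -[eval L]addr0 k1 sL /=; ring.
move: sc; rewrite !cost_cat !cost_cons /cost sB sL; lia.
Qed.

End Digits.

(** * The affine action of the group *)

Section Model.
Variable n : nat.
Hypothesis n_gt0 : (0 < n)%N.
Implicit Types (w u v : word) (g h p : BS n) (q : rat * int).
Local Notation b := (n%:R : rat).

Let b0 : b != 0. Proof. by rewrite pnatr_eq0 -lt0n. Qed.

(** Left multiplication by a letter, on the group law
    [(x, k) (y, l) = (x + n ^ k y, k + l)]. *)
Definition act1 (x : letter) q : rat * int :=
  match x with
  | (gen_a, false) => (q.1 + 1, q.2)
  | (gen_a, true) => (q.1 - 1, q.2)
  | (gen_t, false) => (b * q.1, q.2 + 1)
  | (gen_t, true) => (b^-1 * q.1, q.2 - 1)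
  end.

Definition act w q := foldr act1 q w.

Lemma act_cat u v q : act (u ++ v) q = act u (act v q).
Proof. exact: foldr_cat. Qed.

Lemma act_nseq_a k q : act (nseq k (gen_a, false)) q = (q.1 + k%:R, q.2).
Proof.
elim: k => [|k IH] /=; first by rewrite addr0; case: q.
by rewrite IH /= -addrA -natr1.
Qed.

Lemma act_eq u v : bs_eq n u v -> act u =1 act v.
Proof.
elim=> {u v} //.
- by move=> u v _ h q; rewrite h.
- by move=> u v w _ h1 _ h2 q; rewrite h1 h2.
- by move=> u u' v v' _ h1 _ h2 q; rewrite !act_cat h1 h2.
- case=> [[] []] [x k] /=; congr pair; rewrite ?subrK ?addrK ?mulKf ?mulVKf //.
- move=> [x k]; rewrite act_nseq_a /=; congr pair; last by rewrite subrK.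
  by rewrite mulrDr mulVKf // mulr1.
Qed.

Definition coord g : rat * int := act (repr g) (0, 0).

Lemma coord_pi w : coord (\pi_(BS n) w) = act w (0, 0).
Proof. exact/act_eq/bs_repr_pi. Qed.

Lemma act_affine w q :
  act w q = ((act w (0, 0)).1 + b ^ (act w (0, 0)).2 * q.1, (act w (0, 0)).2 + q.2).
Proof.
elim: w => [|x w IH] /=; first by rewrite add0r expr0z mul1r add0r; case: q.
rewrite IH {IH}; move: (act w (0, 0)) q => [y k] [z m]; case: x => [[] []] /=.
- by rewrite addrAC.
- by rewrite addrAC.
- by rewrite mulrDr mulrA addrAC expfzDr ?b0 // exprN1 [b ^ k * _]mulrC.
- by rewrite mulrDr mulrA addrAC expfzDr ?b0 // expr1z [b ^ k * _]mulrC.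
Qed.

Lemma coordM g h :
  coord (g * h)%g = ((coord g).1 + b ^ (coord g).2 * (coord h).1,
                     (coord g).2 + (coord h).2).
Proof.
elim/bs_ind: g => u; elim/bs_ind: h => v.
have -> : ((\pi_(BS n) u : BS n) * \pi_(BS n) v)%g = \pi_(BS n) (u ++ v).
  exact: bs_mul_pi.
by rewrite !coord_pi act_cat act_affine.
Qed.

Lemma coord1 : coord 1%g = (0, 0).
Proof. exact: coord_pi. Qed.

Lemma coordV g : coord (g^-1)%g = (- (b ^ (- (coord g).2) * (coord g).1), - (coord g).2).
Proof.
have := coordM (g^-1)%g g; rewrite mulVg coord1 => -[h1 h2].
have e : (coord g^-1%g).2 = - (coord g).2 by lia.
rewrite [LHS]surjective_pairing e; congr pair.
by rewrite -e; apply/eqP; rewrite -addr_eq0 -h1.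
Qed.

Definition a_power c : word := nseq `|c|%N (gen_a, c < 0 :> int).

Lemma act_a_power c q : act (a_power c) q = (q.1 + c%:~R, q.2).
Proof.
have h k s : act (nseq k (gen_a, s)) q = (q.1 + (if s then - k%:R else k%:R), q.2).
  elim: k => [|k IH] /=; first by case: (s); rewrite ?oppr0 addr0; case: (q).
  by rewrite IH; case: (s) => /=; rewrite -addrA -natr1 ?opprD.
rewrite h; congr (_ + _, _); case: ltrP => c0.
  by rewrite pmulrn abszE ltr0_norm // mulrNz opprK.
by rewrite pmulrn abszE ger0_norm.
Qed.

Lemma act_nseq_t k q : act (nseq k (gen_t, false)) q = (b ^+ k * q.1, q.2 + k%:Z).
Proof.
elim: k => [|k IH] /=; first by rewrite mul1r addr0; case: q.
by rewrite IH exprS mulrA /=; congr pair; lia.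
Qed.

Lemma act_nseq_tV k q : act (nseq k (gen_t, true)) q = (b ^- k * q.1, q.2 - k%:Z).
Proof.
elim: k => [|k IH] /=; first by rewrite invr1 mul1r subr0; case: q.
by rewrite IH exprS invfM mulrA /=; congr pair; lia.
Qed.

Local Notation a := (bs_a n).
Local Notation t := (bs_t n).

Lemma bs_t_aX k : (t * a ^+ k = a ^+ (n * k) * t)%g.
Proof.
elim: k => [|k IH]; first by rewrite muln0 !expg0 mul1g mulg1.
rewrite expgS mulgA mulnS expgnDr -[RHS]mulgA -IH mulgA -bs_relation.
by rewrite mulgVK.
Qed.

Lemma bs_a_tV i : (a * t ^- i = t ^- i * a ^+ (n ^ i))%g.
Proof.
have h2 : (t ^+ i * a = a ^+ (n ^ i) * t ^+ i)%g.
  elim: i => [|i IH]; first by rewrite expn0 !expg0 mul1g mulg1.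
  by rewrite expgS -mulgA IH mulgA bs_t_aX -mulgA expnS.
by apply: (mulgI (t ^+ i)%g); rewrite !mulgA mulgV mul1g h2 mulgK.
Qed.

Lemma bs_normal_form g :
  exists i j k l, (g = t ^- i * (a ^+ k * a ^- l) * t ^+ j)%g.
Proof.
elim/bs_ind: g; elim=> [|x w [i [j [k [l IH]]]]].
  by exists 0%N, 0%N, 0%N, 0%N; rewrite !expg0 !invg1 !mul1g.
have -> : (\pi_(BS n) (x :: w) = letter_val n x * \pi_(BS n) w :> BS n)%g.
  by rewrite -!word_valE /word_val big_cons.
rewrite IH; case: x => [[] []]; rewrite /letter_val /=.
- exists i, j, k, (n ^ i + l)%N.
  have -> : (a^-1 * (t ^- i * (a ^+ k * a ^- l) * t ^+ j) =
     a^-1 * t ^- i * (a ^+ k * a ^- l) * t ^+ j)%g by rewrite !mulgA.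
  have -> : (a^-1 * t ^- i = t ^- i * a ^- (n ^ i))%g.
    by apply: (mulgI a); rewrite mulVKg mulgA bs_a_tV mulgK.
  congr (_ * _)%g; rewrite -!mulgA; congr (_ * _)%g.
  rewrite [in RHS]addnC expgnDr invgM !mulgA; congr (_ * _)%g.
  by apply/commute_sym/commuteV/commuteX2.
- exists i, j, (n ^ i + k)%N, l.
  by rewrite !mulgA bs_a_tV expgnDr !mulgA.
- by exists i.+1, j, k, l; rewrite expgSr invgM !mulgA.
- case: i {IH} => [|i].
  + exists 0%N, j.+1, (n * k)%N, (n * l)%N.
    rewrite !expg0 invg1 !mul1g !mulgA bs_t_aX expgS !mulgA; congr (_ * _)%g.
    rewrite -!mulgA; congr (_ * _)%g.
    by apply: (mulIg (a ^+ l)%g); rewrite -mulgA mulVg mulg1 -mulgA bs_t_aX !mulgA mulVg mul1g.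
  + by exists i, j, k, l; rewrite expgSr invgM !mulgA mulgV mul1g.
Qed.

Lemma coordX_a k : coord (a ^+ k)%g = (k%:R, 0).
Proof.
elim: k => [|k IH]; first exact: coord1.
rewrite expgS coordM IH coord_pi /= expr0z mul1r add0r addr0.
by rewrite addrC natr1.
Qed.

Lemma coordX_t k : coord (t ^+ k)%g = (0, k%:Z).
Proof.
elim: k => [|k IH]; first exact: coord1.
rewrite expgS coordM IH coord_pi /= mulr0 addr0; congr pair; lia.
Qed.

(** The coordinates of a normal form are [((k - l) / n ^ i, j - i)], hence only
    the trivial element has trivial coordinates. *)
Lemma coord_inj : injective coord.
Proof.
have h g : coord g = (0, 0) -> g = 1%g.
  have [i [j [k [l ->]]]] := bs_normal_form g.
  rewrite !coordM !coordV !coordX_t !coordX_a /= !mulr0 !oppr0 !addr0 add0r.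
  rewrite expr0z !mul1r => -[h1 h2].
  have ij : i = j by lia.
  move/eqP: h1; rewrite mulf_eq0 expfz_eq0 (negbTE b0) andbF /= subr_eq0 eqr_nat.
  by move=> /eqP->; rewrite ij mulgV mulg1 mulVg.
move=> g g' e; apply: (mulIg (g'^-1)%g); rewrite mulgV; apply: h.
by rewrite coordM e -coordM mulgV coord1.
Qed.

Lemma element_with_coord (X : int) (z k : nat) :
  exists g : BS n, coord g = (b ^- z * X%:~R, k%:Z).
Proof.
exists (\pi_(BS n) (nseq z (gen_t, true) ++ a_power X ++ nseq (z + k) (gen_t, false))).
rewrite coord_pi !act_cat act_nseq_tV act_a_power act_nseq_t /= mulr0 !add0r.
by congr pair; lia.
Qed.

End Model.

(** * Word length in terms of digit strings *)

Section Length.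
Variable n : nat.
Implicit Types (w u v : word) (g h p : BS n) (q : rat * int) (s : seq int).
Local Notation b := (n%:R : rat).
Local Notation ev s := ((eval n%:Z s)%:~R : rat).

Lemma length_le_size w : (word_length (\pi_(BS n) w : BS n) <= size w)%N.
Proof.
rewrite /word_length; case: ex_minnP => m _; apply; apply/asboolP.
by exists w => //; rewrite word_valE.
Qed.

Lemma geodesic_word g : exists2 w, \pi_(BS n) w = g & size w = word_length g.
Proof.
rewrite /word_length; case: ex_minnP => m /asboolP[w <- wg] _.
by exists w => //; rewrite -wg word_valE.
Qed.

Lemma pi_cat u v : (\pi_(BS n) (u ++ v) = (\pi_(BS n) u : BS n) * \pi_(BS n) v :> BS n)%g.
Proof. by symmetry; exact: bs_mul_pi. Qed.

Lemma lengthM g h : (word_length (g * h)%g <= word_length g + word_length h)%N.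
Proof.
have [u <- <-] := geodesic_word g; have [v <- <-] := geodesic_word h.
by rewrite -pi_cat -size_cat length_le_size.
Qed.

Lemma lengthV g : word_length (g^-1)%g = word_length g.
Proof.
have h k : (word_length (k^-1)%g <= @word_length n k)%N.
  have [u <- <-] := geodesic_word k.
  have -> : ((\pi_(BS n) u : BS n)^-1)%g = \pi_(BS n) (inv_word u) by exact: bs_inv_pi.
  by apply: leq_trans (length_le_size _) _; rewrite size_rev size_map.
by apply/eqP; rewrite eqn_leq h /= -{1}(invgK g) h.
Qed.

Lemma length1 : word_length (1%g : BS n) = 0%N.
Proof. by apply/eqP; rewrite -leqn0; exact: length_le_size [::]. Qed.

Lemma length_tX_le k : (word_length (bs_t n ^+ k)%g <= k)%N.
Proof.
elim: k => [|k IH]; first by rewrite length1.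
rewrite expgS; apply: leq_trans (lengthM _ _) _; rewrite -[k.+1]add1n leq_add //.
exact: length_le_size [:: (gen_t, false)].
Qed.

Lemma ball_finite k : finite_set [set g : BS n | (word_length g <= k)%N].
Proof.
have -> : [set g : BS n | (word_length g <= k)%N] = \bigcup_(i in `I_k.+1) sphere n i.
  apply/seteqP; split => [g gk|g [i ik gi]]; first by exists (word_length g).
  by move: ik; rewrite /= -gi ltnS.
by apply: bigcup_finite => [|i _]; [exact: finite_II | exact: sphere_finite].
Qed.

Lemma card_le_image (T : choiceType) (P : set T) (A B : set (BS n)) (F : T -> BS n -> BS n) :
  finite_set P -> finite_set A -> finite_set B ->
  (forall g, A g -> exists x h, [/\ P x, B h & g = F x h]) ->
  (Defs.card A <= #|` fset_set P| * Defs.card B)%N.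
Proof.
move=> Pf Af Bf AF; rewrite -(size_allpairs F); apply: uniq_leq_size => [|g].
  exact: fset_uniq.
rewrite in_fset_set // => /set_mem/AF[x [h [Px Bh ->]]].
by apply: allpairs_f; rewrite in_fset_set //; exact: mem_set.
Qed.

Hypothesis n_gt0 : (0 < n)%N.

Let b0 : b != 0. Proof. by rewrite pnatr_eq0 -lt0n. Qed.

(** A word is a walk on the levels: [t] moves between levels and a letter [a]
    read at level [i] changes the digit at level [i] by one. The string [s]
    records the digits of the levels visited, and [z] is the position of
    level 0 in [s]. *)
Lemma word_digits w : exists s (z : nat),
  [/\ ev s = b ^+ z * (act n w (0, 0)).1, (z < size s)%N,
      0 <= z%:Z + (act n w (0, 0)).2 < (size s)%:Z &
      norm1 s + 2 * ((size s)%:Z - 1) - `|(act n w (0, 0)).2| <= (size w)%:Z].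
Proof.
elim: w => [|x w]; first by exists [:: 0], 0%N; split; rewrite /= ?mulr0 //.
rewrite /=; move: (act n w (0, 0)) => [y k] [s [z /= [sy zs zk sw]]].
have addc c : ev s = b ^+ z * y -> exists s', [/\ size s' = size s,
    ev s' = b ^+ z * (y + c%:~R) & norm1 s' <= norm1 s + `|c|].
  move=> es; have [s' [h1 h2 h3]] := eval_add_at n%:Z c zs; exists s'; split => //.
  rewrite h2 rmorphD /= es rmorphM rmorphXn /= mulrDr; congr (_ + _).
  by rewrite mulrC.
case: x => [[] []] /=.
- have [s' [h1 h2 h3]] := addc (-1) sy.
  by exists s', z; split; rewrite ?h1 //; lia.
- have [s' [h1 h2 h3]] := addc 1 sy.
  by exists s', z; split; rewrite ?h1 //; lia.
- have [zs'|zs'] := ltnP z.+1 (size s).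
    exists s, z.+1; split => //; try lia.
    by rewrite exprSr -mulrA mulVKf.
  exists (s ++ [:: 0]), z.+1; rewrite size_cat norm1_cat /=; split; try lia.
  by rewrite eval_cat /= mulr0 addr0 mulr0 addr0 exprSr -mulrA mulVKf.
- case: z sy zs zk sw {addc} => [|z] sy zs zk sw.
    exists (0 :: s), 0%N; rewrite /=; split; try lia.
    by rewrite add0r rmorphM /= sy !mul1r.
  exists s, z; split; try lia.
  by rewrite sy exprSr mulrA.
Qed.

Fixpoint digit_word s : word :=
  match s with
  | [::] => [::]
  | d :: s1 => a_power d ++ (if s1 is [::] then [::] else (gen_t, false) :: digit_word s1)
  end.

Lemma act_digit_word s k : act n (digit_word s) (0, k) = (ev s, k + ((size s).-1)%:Z).
Proof.
elim: s => [|d [|d1 s] IH]; first by rewrite /= addr0.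
  by rewrite /= cats0 act_a_power //= add0r mulr0 !addr0.
have -> : eval n%:Z [:: d, d1 & s] = d + n%:Z * eval n%:Z (d1 :: s) by [].
have -> : digit_word [:: d, d1 & s] = a_power d ++ (gen_t, false) :: digit_word (d1 :: s) by [].
rewrite act_cat act_a_power // [act _ (_ :: _) _]/= -/(act n _ _) IH.
move: (eval _ _) => E /=; congr pair; last by lia.
by rewrite rmorphD rmorphM addrC.
Qed.

Lemma size_digit_word s : (size (digit_word s))%:Z = norm1 s + ((size s).-1)%:Z.
Proof.
elim: s => [|d [|d1 s] IH] //; first by rewrite /= cats0 size_nseq; lia.
have -> : digit_word [:: d, d1 & s] = a_power d ++ (gen_t, false) :: digit_word (d1 :: s) by [].
have -> : norm1 [:: d, d1 & s] = `|d| + norm1 (d1 :: s) by [].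
by move: (digit_word _) (norm1 (_ :: _)) IH => W N; rewrite size_cat size_nseq /=; lia.
Qed.

(** For a final height [k >= 0] the walk that goes down to the lowest level,
    climbs to the highest one and returns to level [k] has
    [2 (size s - 1) - k] moves; the position [z] of level 0 does not matter. *)
Lemma length_le_cost g s (z k : nat) : (coord g).2 = k%:Z ->
  ev s = b ^+ z * (coord g).1 -> (z + k < size s)%N ->
  (word_length g)%:Z <= cost s - 2 - k%:Z.
Proof.
move=> gk gs zk.
pose w := nseq z (gen_t, true) ++ digit_word s ++ nseq ((size s).-1 - (z + k)) (gen_t, true).
have <- : \pi_(BS n) w = g.
  apply: (coord_inj n_gt0); rewrite coord_pi // !act_cat !(act_nseq_tV n_gt0) mulr0 sub0r.
  rewrite act_digit_word gs mulKf ?expf_neq0 //=.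
  by rewrite [RHS]surjective_pairing gk; congr pair; lia.
have := length_le_size w; have := size_digit_word s.
by rewrite /cost !size_cat !size_nseq; lia.
Qed.

Lemma geodesic_digits g : exists s (z : nat),
  [/\ ev s = b ^+ z * (coord g).1, (z < size s)%N,
      0 <= z%:Z + (coord g).2 < (size s)%:Z &
      norm1 s + 2 * ((size s)%:Z - 1) - `|(coord g).2| <= (word_length g)%:Z].
Proof.
have [w <- <-] := geodesic_word g; rewrite coord_pi //; exact: word_digits.
Qed.

Lemma height_le_length g : (`|(coord g).2| <= word_length g)%N.
Proof.
have [s [z [_ zs zk sl]]] := geodesic_digits g.
have := norm1_ge0 s; lia.
Qed.

Lemma length_tX k : word_length (bs_t n ^+ k)%g = k.
Proof.
apply/eqP; rewrite eqn_leq length_tX_le.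
by have := height_le_length (bs_t n ^+ k)%g; rewrite coordX_t //.
Qed.

Lemma card_sphere_gt0 k : (0 < Defs.card (sphere n k))%N.
Proof.
rewrite /Defs.card cardfs_gt0; apply/fset0Pn; exists (bs_t n ^+ k)%g.
by rewrite in_fset_set; [apply/mem_set/length_tX | exact: sphere_finite].
Qed.

End Length.

(** * Numbers with two windows of free digits *)

Section Windows.
Variable n : nat.
Local Notation b := (n%:R : rat).
Local Notation ev s := ((eval n%:Z s)%:~R : rat).
Local Notation bdd := (bounded n%:Z).
Implicit Types (g h p : BS n) (s L M H W Y P T : seq int).

Lemma ev_cat s s' : ev (s ++ s') = ev s + b ^+ size s * ev s'.
Proof. by rewrite eval_cat rmorphD rmorphM rmorphXn. Qed.

Hypothesis n3 : (3 <= n)%N.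

Let n_gt0 : (0 < n)%N. Proof. exact: ltnW (ltnW n3). Qed.
Let b0 : b != 0. Proof. by rewrite pnatr_eq0 -lt0n. Qed.
Let b3 : 3 <= n%:Z. Proof. by lia. Qed.

(** As [0 < |d| < n], the number [X] of the string is not divisible by [n], so a
    string for [x] has at least [z] levels below level 0; and as the upper part is
    not a mere carry, a bounded string reaches above the levels of [d :: P]. So
    every cheapest walk has the levels 0 and [k] in its range, and the length is
    the least cost of [X] up to a constant. *)
Lemma length_le_has_cost g (d : int) P H (z k : nat) (N : int) : d != 0 -> bdd (d :: P) ->
  2 <= `|eval n%:Z H| -> (coord g).2 = k%:Z ->
  ev (d :: P ++ H) = b ^+ z * (coord g).1 -> (z + k <= (size P).+1)%N ->
  (word_length g)%:Z <= N <-> has_cost n%:Z (eval n%:Z (d :: P ++ H)) (N + 2 + k%:Z).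
Proof.
move=> d0 Pb H2 gk gX zk; split; last first.
  move=> /(normalize b3)[s [sb es cs]].
  have sP : (size (d :: P) < size s)%N by apply: (size_gt_prefix b3 Pb H2).
  have := @length_le_cost _ n_gt0 g s z k gk; rewrite es gX => /(_ erefl).
  by move: sP => /= sP; have zs : (z + k < size s)%N by [lia]; move/(_ zs); lia.
move=> gN; have [s [z' [es zs' _ cs]]] := geodesic_digits n_gt0 g.
have [zz|zz] := leqP z z'.
  apply: (@has_cost_divX _ b3 _ (z' - z)); exists s; last by move: cs; rewrite gk /cost; lia.
  move: (eval _ (d :: _)) gX => X gX.
  apply: (@intr_inj rat); rewrite es rmorphM rmorphXn /= gX mulrA -exprD.
  by congr (_ ^+ _ * _); lia.
exfalso; have : eval n%:Z (d :: P ++ H) = n%:Z ^+ (z - z') * eval n%:Z s.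
  move: (eval _ (d :: _)) gX => X gX.
  apply: (@intr_inj rat); rewrite rmorphM rmorphXn /= es gX mulrA -exprD.
  by congr (_ ^+ _ * _); lia.
(* Otherwise [n] divides the lowest digit [d]. *)
have -> : (z - z' = (z - z').-1.+1)%N by lia.
move: Pb => /= /andP[db _]; rewrite exprS; move: (eval _ _) (eval _ _) (_ ^+ _).
move=> y x q /= e; have dk : d = n%:Z * (q * y - x).
  by rewrite mulrBr mulrA -e addrK.
move: (q * y - x) dk d0 db b3 => j -> + + b3'; clear.
by have [->|] := eqVneq j 0; nia.
Qed.

Lemma strip_zeros L (c : int) : c != 0 ->
  exists j L', L ++ [:: c] = nseq j 0 ++ L' /\ head 0 L' != 0.
Proof.
move=> c0; elim: L => [|d L [j [L' [e h]]]]; first by exists 0%N, [:: c].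
have [->|d0] := eqVneq d 0; first by exists j.+1, L'; rewrite /= e.
by exists 0%N, (d :: L ++ [:: c]).
Qed.

Lemma horizontal_element T (z : nat) : bdd T -> (z < size T)%N ->
  exists g, coord g = (b ^- z * ev T, 0) /\ (word_length g <= n.+2 * size T)%N.
Proof.
move=> Tb zT; have [g gT] := element_with_coord n_gt0 (eval n%:Z T) z 0.
exists g; split => //.
have := length_le_cost (g := g) (s := T) (z := z) (k := 0) n_gt0.
rewrite gT mulVKf ?expf_neq0 // addn0 => /(_ erefl erefl zT).
by have := norm1_bounded b3 Tb; rewrite /cost; nia.
Qed.

Lemma change_element T T' (z : nat) : bdd T -> bdd T' -> size T' = size T ->
  (z < size T)%N -> exists g, coord g = (b ^- z * (ev T' - ev T), 0) /\
    (word_length g <= 2 * (n.+2 * size T))%N.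
Proof.
move=> Tb Tb' sT zT; have [g [gT gl]] := horizontal_element Tb zT.
rewrite -sT in zT; have [h [hT hl]] := horizontal_element Tb' zT.
exists (h * g^-1)%g; split; last first.
  by apply: leq_trans (lengthM _ _) _; rewrite lengthV mul2n -addnn -{1}sT leq_add.
rewrite (coordM n_gt0) (coordV n_gt0) gT hT /= oppr0 expr0z !mul1r addr0; congr pair.
by rewrite mulrBr.
Qed.

(** The choice of the digit below [H] makes sure that the highest part of a string
    cannot be mistaken for a carry. *)
Lemma top_digit H : exists q : int, `|q| < n%:Z /\ 2 <= `|eval n%:Z (q :: H)|.
Proof.
have [e0|e0] := eqVneq (eval n%:Z H) 0.
  by exists 2; rewrite /= e0; lia.
by exists 1; rewrite /=; move: (eval _ _) e0 => e e0; split; nia.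
Qed.

Variable r : nat.

(** The levels [1 - r, .., r - 1] around a centre, with the digits that arise from
    [r] by a change of at most [r]. *)
Definition window W : bool :=
  (size W == (2 * r).-1)%N && all (fun d => (0 <= d) && (d <= 2 * r%:Z)) W.

Definition block W := 0 :: W ++ [:: 0].

Definition flat_window : seq int := nseq (2 * r).-1 r%:Z.

(** The nonzero lowest digit of [L] and the value of [H], which exceeds any carry,
    force the cheapest strings to cover all the levels between them. *)
Definition shape L M H : bool :=
  [&& bdd L, head 0 L != 0, bdd M, bdd H & 2 <= `|eval n%:Z H|].

Definition layout L W1 M W2 H := L ++ block W1 ++ M ++ block W2 ++ H.

(** The windows are centred at level 0 and at level [k], which is where
    conjugation by a short element acts; both consist of digits [r]. *)
Definition good g := exists L M H, [/\ shape L M H,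
  ev (layout L flat_window M flat_window H) = b ^+ (size L + r) * (coord g).1 &
  (coord g).2 = (size M + (2 * r).+1)%:Z].

Lemma good_height_gt0 g : good g -> (0 < (coord g).2)%R.
Proof. by case=> L [M [H [_ _ ->]]]; rewrite addnS. Qed.

Hypothesis r1 : (1 <= r)%N.

Lemma size_block W : window W -> size (block W) = (2 * r).+1.
Proof. by case/andP=> /eqP sW _; rewrite /= size_cat sW /=; lia. Qed.

Lemma window_flat : window flat_window.
Proof. by rewrite /window size_nseq eqxx all_nseq; apply/orP; right; lia. Qed.

(** Digits up to [2 r] have to be optimal. For [2 (2 r) <= n - 1] this holds for
    several adjacent digits; a single digit may be as large as [(n + 1) / 2],
    which covers [r = 1] for [n = 3] and [n = 4]. *)
Hypothesis rn : (r = 1 \/ 4 * r + 1 <= n)%N.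

Lemma window_bounded W : window W -> bdd W.
Proof. by case/andP=> _; apply: sub_all => d; lia. Qed.

Lemma block_bounded W : window W -> bdd (block W).
Proof.
by move=> /window_bounded Wb; rewrite /= bounded_cat Wb /=; lia.
Qed.

Lemma block_rigid W : window W -> rigid n%:Z (block W).
Proof.
move=> Ww; apply: (rigid_flank b3); first exact: window_bounded.
case/andP: Ww => /eqP sW Wd; case: rn => [r_1|r4]; last first.
  by apply: (subrigid_small b3); apply: sub_all Wd => d; lia.
move: sW Wd; rewrite r_1; case: W => [//|d [|//]] _ /= /andP[/andP[d0 d2] _].
by apply: (subrigid1 b3); lia.
Qed.

(** Two exchanges of blocks whose costs cancel. *)
Lemma has_cost_layout L W1 W1' M W2 W2' H c : shape L M H ->
  window W1 -> window W1' -> window W2 -> window W2' ->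
  norm1 W1' + norm1 W2' = norm1 W1 + norm1 W2 ->
  has_cost n%:Z (eval n%:Z (layout L W1 M W2 H)) c ->
  has_cost n%:Z (eval n%:Z (layout L W1' M W2' H)) c.
Proof.
case/and5P=> Lb _ Mb Hb H2 w1 w1' w2 w2' e.
have U2 : 2 <= `|eval n%:Z (M ++ block W2 ++ H)|.
  by do 2! apply: (eval_ge2 b3) => //; exact: block_bounded.
move/(swap_rigid b3 (B0 := block W1') Lb (block_bounded w1) (block_rigid w1) isT U2).
have -> : eval n%:Z (L ++ block W1' ++ M ++ block W2 ++ H) =
  eval n%:Z ((L ++ block W1' ++ M) ++ block W2 ++ H) by rewrite !catA.
have Lb' : bdd (L ++ block W1' ++ M).
  by rewrite !bounded_cat Lb block_bounded // Mb.
move/(swap_rigid b3 (B0 := block W2') Lb' (block_bounded w2) (block_rigid w2) isT H2).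
rewrite /layout !catA => -[s es cs]; exists s => //; apply: le_trans cs _.
rewrite /cost !size_block // /block /= !norm1_cat /=; lia.
Qed.

Lemma length_layout g L W1 M W2 H (z : nat) (N : int) :
  shape L M H -> window W1 -> window W2 ->
  (coord g).2 = (size M + (2 * r).+1)%:Z ->
  ev (layout L W1 M W2 H) = b ^+ z * (coord g).1 ->
  (z <= size L + (2 * r).+1)%N ->
  (word_length g)%:Z <= N <->
  has_cost n%:Z (eval n%:Z (layout L W1 M W2 H)) (N + 2 + (size M + (2 * r).+1)%:Z).
Proof.
case/and5P=> Lb L0 Mb Hb H2 w1 w2 gk.
have -> : layout L W1 M W2 H = head 0 L :: (behead L ++ block W1 ++ M ++ block W2) ++ H.
  by case: (L) L0 => // d L1 _; rewrite [behead _]/= [head _ _]/= -!catA.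
move=> gX zL; apply: (length_le_has_cost N L0 _ H2 gk gX); last first.
  rewrite !size_cat !size_block //; case: (L) L0 zL => [|d L'] //= _; lia.
have -> : head 0 L :: behead L ++ block W1 ++ M ++ block W2 =
   L ++ block W1 ++ M ++ block W2 by case: (L) L0.
by rewrite !bounded_cat Lb Mb !block_bounded.
Qed.

(** * Conjugation by short elements *)

(** It takes [|i|] letters to reach level [i], so a word of length at most [r]
    reads [a] only at levels [i] with [|i| < r]. *)
Lemma ball_digits p : (word_length p <= r)%N -> exists Y,
  [/\ size Y = (2 * r).-1, all (fun y => `|y| <= r%:Z) Y,
      ev Y = b ^+ r.-1 * (coord p).1 & `|(coord p).2| <= r%:Z].
Proof.
move=> pr; have [s [z [es zs]]] := geodesic_digits n_gt0 p.
move: ((coord p).1) es ((coord p).2) => y es m zm sp.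
have sr : norm1 s + (size s)%:Z - 1 <= r by lia.
have s0 := norm1_ge0 s.
have [s00|s0'] := eqVneq (norm1 s) 0.
  exists (nseq (2 * r).-1 0); rewrite size_nseq all_nseq eval_nseq0; split => //.
  - by apply/orP; right; lia.
  - have es0 : eval n%:Z s = 0.
      elim: (s) s00 => //= d s1 IH; have := norm1_ge0 s1 => ? ?.
      by rewrite IH; lia.
    move: es; rewrite es0 => /esym/eqP; rewrite mulf_eq0 expf_eq0 (negbTE b0) andbF.
    by move=> /eqP->; rewrite mulr0.
  - by lia.
exists (nseq (r.-1 - z) 0 ++ s ++ nseq (r + z - size s) 0); split.
- by rewrite !size_cat !size_nseq; lia.
- rewrite !all_cat !all_nseq; have -> : (`|0 : int| <= r%:Z) = true by lia.
  rewrite !orbT andbT /=; have : norm1 s <= r%:Z by lia.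
  elim: (s) => //= d s1 IH; have := norm1_ge0 s1 => ? ?.
  by rewrite IH; lia.
- rewrite !ev_cat !eval_nseq0 size_nseq mulr0 add0r addr0 es mulrA -exprD.
  by congr (_ ^+ _ * _); lia.
- by lia.
Qed.

(** Conjugation by [p = (y, m)] moves the positions of levels 0 and [k] by [m],
    which does not change the length, and replaces [x] by [x - y + n ^ k y].
    The lower window becomes [r - Y] and the upper one [r + Y], where [Y] are the
    digits of [y]: what one window loses the other gains. *)
Lemma conj_length g p : good g -> (word_length p <= r)%N ->
  word_length (g ^ p)%g = word_length g.
Proof.
case=> L [M [H [sh gX gk]]] pr; have [Y [sY Yr eY pm]] := ball_digits pr.
have /(congr1 (@coord n)) : (g * p = p * g ^ p)%g by rewrite -conjgC.
rewrite (coordM n_gt0 g p) (coordM n_gt0 p (g ^ p)%g).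
case ec: (coord (g ^ p)%g) => [c k'] /= [e1 e2].
have ek : k' = (size M + (2 * r).+1)%:Z.
  by rewrite -gk; apply: (addrI (coord p).2); rewrite -e2 addrC.
pose W1 := [seq r%:Z + (-1) * y | y <- Y]; pose W2 := [seq r%:Z + 1 * y | y <- Y].
have w1 : window W1.
  rewrite /window size_map sY eqxx all_map; apply: sub_all Yr => y /=; lia.
have w2 : window W2.
  rewrite /window size_map sY eqxx all_map; apply: sub_all Yr => y /=; lia.
have nW : norm1 W1 + norm1 W2 = norm1 flat_window + norm1 flat_window.
  rewrite /W1 /W2 /flat_window -sY; elim: (Y) Yr => //= y Y1 IH /andP[yr /IH]; lia.
have [z ez] : exists z : nat, z%:Z = (size L + r)%:Z + (coord p).2.
  by exists `|((size L + r)%:Z + (coord p).2)%R|%N; lia.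
have eX : ev (layout L W1 M W2 H) = b ^+ z * c.
  have -> : b ^+ z * c = b ^+ (size L + r) * (b ^ (coord p).2 * c).
    by rewrite mulrA exprnP ez expfzDr.
  have -> : b ^ (coord p).2 * c = (coord g).1 + b ^ (coord g).2 * (coord p).1 - (coord p).1.
    by rewrite e1 addrAC subrr add0r.
  have evd V1 V2 : window V1 -> window V2 -> ev (layout L V1 M V2 H) =
      ev L + b ^+ size L * (b * ev V1 + b ^+ (2 * r).+1 *
        (ev M + b ^+ size M * (b * ev V2 + b ^+ (2 * r).+1 * ev H))).
    have eb W : ev (block W) = b * ev W.
      by rewrite /block /= eval_cat /= mulr0 addr0 mulr0 addr0 add0r rmorphM.
    by move=> wV1 wV2; rewrite /layout !ev_cat !eb !size_block.
  have eW1 : ev W1 = ev flat_window - b ^+ r.-1 * (coord p).1.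
    by rewrite eval_shift sY rmorphD rmorphM /= eY mulN1r.
  have eW2 : ev W2 = ev flat_window + b ^+ r.-1 * (coord p).1.
    by rewrite eval_shift sY rmorphD rmorphM /= eY mul1r.
  rewrite !mulrDr -gX gk -exprnP !evd ?window_flat // eW1 eW2.
  have -> : (size L + r = (size L).+1 + r.-1)%N by lia.
  rewrite !exprD !exprS; ring.
have iff N := length_layout N sh w1 w2 (g := (g ^ p)%g) (z := z).
have iff0 N := length_layout N sh window_flat window_flat gk gX.
rewrite ec /= in iff.
have zL : (z <= size L + (2 * r).+1)%N by lia.
have zL0 : (size L + r <= size L + (2 * r).+1)%N by lia.
apply/eqP; rewrite eqn_leq; apply/andP; split.
  suff : (word_length (g ^ p)%g)%:Z <= (word_length g)%:Z by lia.
  apply/(iff _ ek eX zL); apply: (has_cost_layout sh window_flat w1 window_flat w2 nW).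
  exact/iff0.
suff : (word_length g)%:Z <= (word_length (g ^ p)%g)%:Z by lia.
apply/(iff0 _ zL0); apply: (has_cost_layout sh w1 window_flat w2 window_flat (esym nW)).
exact/(iff _ ek eX zL).
Qed.

(** * Inserting a level *)

(** [h] arises from [g] by inserting a zero level above the window at level 0:
    the number [c] collects the digits up to that window. *)
Definition inserts g h := exists (c : rat) (e : int),
  [/\ `|c| < b ^+ r, (coord g).1 = c + b ^+ r.+1 * e%:~R,
      (coord h).1 = c + b ^+ r.+2 * e%:~R & (coord h).2 = (coord g).2 + 1].

(** As [|c| < n ^ r], the residue of the new number modulo [n ^ (r + 2)]
    determines [c], hence everything. *)
Lemma inserts_inj g1 g2 h : inserts g1 h -> inserts g2 h -> g1 = g2.
Proof.
case=> c1 [e1 [c1s x1 y1 k1]] [c2 [e2 [c2s x2 y2 k2]]].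
have q0 : 0 < b ^+ r by rewrite exprn_gt0 // ltr0n.
have ee : e1 = e2.
  apply/eqP; rewrite -subr_eq0; apply/negPn/negP => e12.
  have : 1 <= `|(e1 - e2)%:~R : rat| by rewrite -intr_norm ler1z; lia.
  have : (e1 - e2)%:~R * b ^+ r.+2 = c2 - c1.
    by rewrite rmorphB /= mulrBl; move: y1; rewrite y2; lra.
  have bb : 3 <= b by rewrite ler_nat.
  move: (e1 - e2)%:~R => w; rewrite !exprS; move: (b ^+ r) q0 c1s c2s => q q0 c1s c2s.
  move=> /(congr1 Num.norm); rewrite !normrM !normr_nat (gtr0_norm q0).
  have : `|c2 - c1| <= `|c2| + `|c1| by rewrite ler_normB.
  move: b bb => B bB; have Bq : 3 * q <= B * q by rewrite ler_wpM2r // ltW.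
  have qB : 3 * (B * q) <= B * (B * q) by rewrite ler_wpM2r //; lra.
  move=> tri eB w1; have B0 : 0 <= B * (B * q) by lra.
  have := ler_peMl B0 w1; rewrite eB; lra.
apply: (coord_inj n_gt0); rewrite [LHS]surjective_pairing [RHS]surjective_pairing.
congr pair; last by lia.
by rewrite x1 x2 ee; move: y1; rewrite y2 ee => /addIr ->.
Qed.

(** A zero digit and two zero digits are both rigid, so that the exchange of one
    for the other changes the length by exactly the one additional step. *)
Lemma insert_level g : good g ->
  exists h, [/\ good h, word_length h = (word_length g).+1 & inserts g h].
Proof.
case=> L [M [H [sh gX gk]]].
have [h hX] := element_with_coord n_gt0 (eval n%:Z (layout L flat_window (0 :: M) flat_window H))
   (size L + r) (size (0 :: M) + (2 * r).+1).
have sh' : shape L (0 :: M) H.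
  by move: sh => /and5P[? ? ? ? ?]; apply/and5P; split => //=; apply/andP; split => //; lia.
have hX' : ev (layout L flat_window (0 :: M) flat_window H) = b ^+ (size L + r) * (coord h).1.
  by rewrite hX mulVKf // expf_neq0.
have hk : (coord h).2 = (size (0 :: M) + (2 * r).+1)%:Z by rewrite hX.
exists h; split.
- by exists L, (0 :: M), H.
- have ww := window_flat.
  have zL : (size L + r <= size L + (2 * r).+1)%N by lia.
  have iffg N := length_layout N sh ww ww gk gX zL.
  have iffh N := length_layout N sh' ww ww hk hX' zL.
  case/and5P: sh => Lb _ Mb Hb H2.
  have bw := block_bounded ww.
  have U2 : 2 <= `|eval n%:Z (M ++ block flat_window ++ H)|.
    by apply: (eval_ge2 b3) => //; exact: (eval_ge2 b3).
  have Lb' : bdd (L ++ 0 :: flat_window).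
    by move: bw; rewrite !bounded_cat Lb /= bounded_cat /= => /and3P[-> -> _].
  (* The last zero of the lower block is exchanged for two zeros. *)
  have eX : layout L flat_window M flat_window H =
      (L ++ 0 :: flat_window) ++ [:: 0] ++ (M ++ block flat_window ++ H).
    by rewrite /layout {1}/block !cat_cons -!catA.
  have eX' : layout L flat_window (0 :: M) flat_window H =
      (L ++ 0 :: flat_window) ++ [:: 0; 0] ++ (M ++ block flat_window ++ H).
    by rewrite /layout {1}/block !cat_cons -!catA.
  have up c : has_cost n%:Z (eval n%:Z (layout L flat_window M flat_window H)) c ->
      has_cost n%:Z (eval n%:Z (layout L flat_window (0 :: M) flat_window H)) (c + 2).
    rewrite eX eX'; move/(swap_rigid b3 (B0 := [:: 0; 0]) Lb' (bounded_nseq0 b3 1)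
      (rigid_nseq0 b3 (k := 0)) isT U2).
    by rewrite /cost /= => -[s es cs]; exists s => //; apply: le_trans cs _; lia.
  have down c : has_cost n%:Z (eval n%:Z (layout L flat_window (0 :: M) flat_window H)) c ->
      has_cost n%:Z (eval n%:Z (layout L flat_window M flat_window H)) (c - 2).
    rewrite eX eX'; move/(swap_rigid b3 (B0 := [:: 0]) Lb' (bounded_nseq0 b3 2)
      (rigid_nseq0 b3 (k := 1)) isT U2).
    by rewrite /cost /= => -[s es cs]; exists s => //; apply: le_trans cs _; lia.
  have le1 : (word_length h)%:Z <= (word_length g)%:Z + 1.
    apply/iffh; have /iffg/up := lexx (word_length g)%:Z.
    by case=> s es cs; exists s => //; move: cs => /=; lia.
  have le2 : (word_length g)%:Z <= (word_length h)%:Z - 1.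
    apply/iffg; have /iffh/down := lexx (word_length h)%:Z.
    by case=> s es cs; exists s => //; move: cs => /=; lia.
  by lia.
- exists (b ^- (size L + r) * ev (L ++ block flat_window)),
    (eval n%:Z (M ++ block flat_window ++ H)); split.
  + have -> : L ++ block flat_window = (L ++ 0 :: flat_window) ++ [:: 0].
      by rewrite /block -catA.
    have -> : ev ((L ++ 0 :: flat_window) ++ [:: 0]) = ev (L ++ 0 :: flat_window).
      by rewrite eval_cat /= mulr0 !addr0 mulr0 addr0.
    have Lb' : bdd (L ++ 0 :: flat_window).
      case/and5P: sh => Lb _ _ _ _; have := block_bounded window_flat.
      by rewrite /= !bounded_cat Lb /= => /and3P[-> -> _].
    have := eval_bounded b3 Lb'; rewrite size_cat /= size_nseq => eb.
    rewrite normrM normfV normrX normr_nat ltr_pdivrMl ?exprn_gt0 ?ltr0n //.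
    rewrite -exprD -intr_norm.
    have -> : b ^+ (size L + r + r) = (n%:Z ^+ (size L + (2 * r).-1.+1))%:~R.
      by rewrite rmorphXn /=; congr (_ ^+ _); lia.
    by rewrite ltr_int.
  + have -> : (coord g).1 = b ^- (size L + r) * ev (layout L flat_window M flat_window H).
      by rewrite gX mulKf // expf_neq0.
    have -> : layout L flat_window M flat_window H =
      (L ++ block flat_window) ++ (M ++ block flat_window ++ H) by rewrite /layout !catA.
    rewrite ev_cat mulrDr size_cat size_block ?window_flat //.
    rewrite mulrA; congr (_ + _ * _).
    rewrite (_ : size L + (2 * r).+1 = size L + r + r.+1)%N; last lia.
    by rewrite [b ^+ (_ + _ + _)]exprD mulKf ?expf_neq0.
  + have -> : (coord h).1 = b ^- (size L + r) * ev (layout L flat_window (0 :: M) flat_window H).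
      by rewrite hX.
    have -> : layout L flat_window (0 :: M) flat_window H =
      (L ++ block flat_window) ++ 0 :: (M ++ block flat_window ++ H) by rewrite /layout !catA.
    move: (M ++ _) => U.
    rewrite ev_cat mulrDr size_cat size_block ?window_flat //.
    have -> : ev (0 :: U) = b * ev U by rewrite /= add0r rmorphM.
    rewrite !mulrA; congr (_ + _ * _).
    rewrite (_ : size L + (2 * r).+1 = size L + r + r.+1)%N; last lia.
    by rewrite [b ^+ (_ + _ + _)]exprD mulKf ?expf_neq0 // -exprSr.
  + by rewrite hX gk /=; lia.
Qed.

(** A left inverse of the insertion of a level, which lets good elements of
    smaller length be described by good elements of length [N]. *)
Definition uninsert h : BS n := xget 1%g [set g | inserts g h].

Lemma insertsK g h : inserts g h -> uninsert h = g.
Proof.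
move=> gh; have hu : inserts (uninsert h) h.
  by rewrite /uninsert; apply: (@xgetPex _ 1%g [set k | inserts k h]); exists g.
exact: (inserts_inj hu gh).
Qed.

Lemma insert_levels i g : good g ->
  exists h, [/\ good h, word_length h = (word_length g + i)%N & iter i uninsert h = g].
Proof.
move=> gg; elim: i => [|i [h [gh hl hi]]]; first by exists g; rewrite addn0.
have [h' [gh' hl' /insertsK e]] := insert_level gh.
by exists h'; split => //; [rewrite hl' hl addnS | rewrite iterSr e].
Qed.

(** * Density *)

(** Take any bounded digits of [h], pad them with zeros, replace the digits
    around levels 0 and [m] by the pattern of a good element, and enlarge the
    height to separate the two windows. A bounded change near level 0 is a left
    multiplication, and near level [m] a right multiplication, by an element of
    bounded length. *)
Lemma reach_good : exists K, forall h (m : nat), (coord h).2 = m%:Z ->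
  exists u v, (word_length u + word_length v <= K)%N /\ good (u * h * v)%g.
Proof.
have b1 : `|1 : int| < n%:Z by lia.
exists (2 * (n.+2 * (2 * r).+2) + ((2 * r).+1 + 2 * (n.+2 * (2 * r).+2)))%N => h m hm.
have [s0 [z [es0 _ _ _]]] := geodesic_digits n_gt0 h.
have exponents : (z.+1 + r + m + (2 * r).+1 = z + (2 * r).+2 + m + r)%N by lia.
have [s [sb es _]] : exists s, [/\ bdd s, eval n%:Z s = eval n%:Z s0 & cost s <= cost s0].
  by apply: (normalize b3); exists s0.
have ww := window_flat.
have bw : bdd (block flat_window) by exact: block_bounded.
have sw : size (block flat_window) = (2 * r).+1 by exact: size_block.
pose t := nseq r.+1 0 ++ s ++ nseq (z + m + (4 * r).+4) 0.
have tb : bdd t by rewrite /t !bounded_cat sb !bounded_nseq0.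
have et : ev t = b ^+ (r.+1 + z) * (coord h).1.
  rewrite /t !ev_cat !eval_nseq0 mulr0 addr0 add0r size_nseq es es0.
  by rewrite mulrA -exprD.
have [L [T1 [M [T2 [H [tE sL sT1 sM sT2]]]]]] : exists L T1 M T2 H,
    [/\ t = L ++ T1 ++ M ++ T2 ++ H, size L = z, size T1 = (2 * r).+2,
        size M = m & size T2 = (2 * r).+2].
  exists (take z t), (take (2 * r).+2 (drop z t)),
    (take m (drop (2 * r).+2 (drop z t))),
    (take (2 * r).+2 (drop m (drop (2 * r).+2 (drop z t)))),
    (drop (2 * r).+2 (drop m (drop (2 * r).+2 (drop z t)))).
  rewrite !cat_take_drop; split => //; rewrite size_takel // ?size_drop;
    by rewrite /t !size_cat !size_nseq; lia.
clearbody t.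
move: tb; rewrite tE !bounded_cat => /and5P[Lb T1b Mb T2b Hb].
(* [L], [T1], [M], [T2], [H] are the digits below, around and between levels 0
   and [m], and above. The last digit below the lower block becomes 1, so that the
   lowest part is not zero; its trailing zeros are stripped. *)
have [q [qb q2]] := top_digit H.
have [j [L' [eL hL]]] := @strip_zeros L 1 isT.
have Lb' : bdd L'.
  have : bdd (L ++ [:: 1]) by rewrite bounded_cat Lb /= b1.
  by rewrite eL bounded_cat => /andP[].
have sL' : (j + size L' = z.+1)%N.
  by have := congr1 size eL; rewrite !size_cat size_nseq sL addn1.
pose T1' := 1 :: block flat_window; pose T2' := block flat_window ++ [:: q].
have T1b' : bdd T1' by rewrite /T1' -cat1s bounded_cat bw /= b1.
have T2b' : bdd T2' by rewrite /T2' bounded_cat bw /= qb.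
have sT1' : size T1' = size T1 by rewrite sT1 /T1' -cat1s size_cat sw.
have sT2' : size T2' = size T2 by rewrite sT2 /T2' size_cat sw addn1.
have z1 : (r.+1 < size T1)%N by rewrite sT1 !ltnS leq_pmull.
have z2 : (r < size T2)%N by rewrite sT2 ltnS ltnW // ltnS leq_pmull.
have [u [uc ul]] := change_element T1b T1b' sT1' z1.
have [v [vc vl]] := change_element T2b T2b' sT2' z2.
have fc : coord (u * h * (bs_t n ^+ (2 * r).+1 * v))%g =
    ((coord u).1 + (coord h).1 + b ^+ m * (b ^+ (2 * r).+1 * (coord v).1),
     (m + (2 * r).+1)%:Z).
  rewrite !(coordM n_gt0) coordX_t // hm uc vc /fst /snd add0r expr0z mul1r add0r.
  by rewrite addr0 -!exprnP -PoszD.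
exists u, (bs_t n ^+ (2 * r).+1 * v)%g; split.
  rewrite sT1 sT2 in ul vl; apply: leq_add => //.
  exact: leq_trans (lengthM _ _) (leq_add (length_tX_le _ _) vl).
exists L', M, (q :: H); split.
- by rewrite /shape Lb' hL Mb /= qb; apply/andP.
- have eD : nseq j 0 ++ layout L' flat_window M flat_window (q :: H) =
      L ++ T1' ++ M ++ T2' ++ H.
    by rewrite /layout catA -eL /T1' -cat1s /T2' -!catA.
  apply: (mulfI (expf_neq0 j b0)); rewrite mulrA -exprD addnA sL'.
  have -> : b ^+ j * ev (layout L' flat_window M flat_window (q :: H)) =
      ev (L ++ T1' ++ M ++ T2' ++ H).
    by rewrite -eD [RHS]ev_cat eval_nseq0 add0r size_nseq.
  rewrite fc uc vc /fst mulrDr [_ * (_ + (coord h).1)]mulrDr.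
  rewrite [b ^+ (z.+1 + r) * (coord h).1](_ : _ = ev t); last first.
    by rewrite et addSnnS addnC.
  rewrite [b ^+ (z.+1 + r) * (b ^- r.+1 * _)](_ : _ = b ^+ z * (ev T1' - ev T1)); last first.
    by rewrite addSnnS exprD -!mulrA mulVKf ?expf_neq0.
  rewrite [b ^+ (z.+1 + r) * _](_ : _ =
    b ^+ (z + (2 * r).+2 + m) * (ev T2' - ev T2)); last first.
    rewrite !mulrA -!exprD; congr (_ * _).
    by rewrite exponents exprD mulfK ?expf_neq0.
  rewrite tE !ev_cat sT1' sT2' sT1 sL sM sT2 !exprD; ring.
- by rewrite fc sM.
Qed.

(** An element [g] of length [N] is a product of an element [h] of length about
    [N - K] and a short one. Up to inversion [h] is within bounded distance of a
    good element, of length between [N - 2 K] and [N], and inserting levels makes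
    this length equal to [N]. All the choices come from a finite set that is
    independent of [N]. *)
Lemma sphere_le_good : exists C K : nat, forall N, (K <= N)%N ->
  (Defs.card (sphere n N) <= C * Defs.card ([set g : BS n | good g] `&` sphere n N))%N.
Proof.
have [K hK] := reach_good.
pose B := [set g : BS n | (word_length g <= K)%N].
pose P := [set: bool] `*` (`I_(2 * K).+1 `*` (B `*` (B `*` B))).
(* The element [g] is recovered from a good [f] of the same length: undo [i]
   insertions and the two multiplications, invert if [s], and multiply by the end
   [q] of a geodesic word. *)
pose F (x : bool * (nat * (BS n * (BS n * BS n)))) (f : BS n) : BS n :=
  let: (s, (i, (u, (v, q)))) := x in
  let h := (u^-1 * iter i uninsert f * v^-1)%g in
  ((if s then h^-1 else h) * q)%g.
exists #|` fset_set P|, K => N KN.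
apply: (card_le_image (F := F)).
- apply: finite_setX; first exact: finite_finset.
  apply: finite_setX; first exact: finite_II.
  by do 2! [apply: finite_setX; first exact: ball_finite]; exact: ball_finite.
- exact: sphere_finite.
- by apply: finite_setIr; exact: sphere_finite.
move=> g gS; have gN : word_length g = N by exact: gS.
have [w wg sw] := geodesic_word g.
pose h : BS n := \pi_(BS n) (take (N - K) w).
pose q : BS n := \pi_(BS n) (drop (N - K) w).
have ghq : g = (h * q)%g by rewrite /h /q -pi_cat cat_take_drop.
have hl : (word_length h <= N - K)%N.
  by apply: leq_trans (length_le_size _ _) _; rewrite size_take_min geq_minl.
have ql : (word_length q <= K)%N.
  by apply: leq_trans (length_le_size _ _) _; rewrite size_drop sw gN; lia.
have hl' : (N <= word_length h + K)%N.
  by rewrite -gN ghq (leq_trans (lengthM _ _)) // leq_add2l.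
have [s [h' [m [hm hh' lh']]]] : exists (s : bool) (h' : BS n) (m : nat),
   [/\ (coord h').2 = m%:Z, h = (if s then h'^-1 else h')%g & word_length h' = word_length h].
  case: (lerP 0 (coord h).2) => h0.
    by exists false, h, `|(coord h).2|%N; split => //; lia.
  exists true, (h^-1)%g, `|(coord h).2|%N; rewrite coordV // invgK lengthV /=.
  by split => //; lia.
have [u [v [uv gf]]] := hK h' m hm.
have h'f : h' = (u^-1 * (u * h' * v) * v^-1)%g by rewrite !mulgA mulVg mul1g mulgK.
set f := (u * h' * v)%g in gf h'f.
have f1 : (word_length f <= word_length u + word_length h + word_length v)%N.
  by rewrite -lh' (leq_trans (lengthM _ _)) // leq_add2r lengthM.
have f2 : (word_length h <= word_length u + word_length f + word_length v)%N.
  rewrite -lh' h'f (leq_trans (lengthM _ _)) // lengthV leq_add2r.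
  by rewrite (leq_trans (lengthM _ _)) // lengthV.
have [f' [gf' lf' if']] := insert_levels (N - word_length f) gf.
exists (s, (N - word_length f, (u, (v, q))))%N, f'; split => /=.
- split => //; split; first by rewrite /= ltnS; lia.
  by rewrite /B; split => /=; [lia | split => /=; lia].
- by split => //; rewrite /sphere /= lf'; lia.
by rewrite if' -h'f -hh' -ghq.
Qed.

(** Good elements have positive height, so no good element is the inverse of a
    good element. *)
Lemma good_le_half N :
  (2 * Defs.card ([set g : BS n | good g] `&` sphere n N) <= Defs.card (sphere n N))%N.
Proof.
set A := _ `&` _.
have Sf := sphere_finite n N.
have Af : finite_set A by apply: finite_setIr.
pose A' := (fun g : BS n => g^-1)%g @` A.
have A'f : finite_set A' by exact: finite_image.
have cA' : #|` fset_set A'| = Defs.card A.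
  by rewrite fset_set_image // card_imfset //; exact: invg_inj.
have sub : (fset_set A `|` fset_set A' `<=` fset_set (sphere n N))%fset.
  rewrite -fset_setU // -fset_set_sub //; last by rewrite finite_setU.
  move=> g [[]//|[h [_ hN] <-]]; by rewrite /sphere /= lengthV.
have dis : (fset_set A `&` fset_set A' = fset0)%fset.
  rewrite -fset_setI // (_ : A `&` A' = set0) ?fset_set0 //.
  apply/seteqP; split => // g [[/good_height_gt0 g1 _] [h [/good_height_gt0 h1 _]]] e.
  by move: g1; rewrite -e coordV //=; lia.
have := fsubset_leq_card sub.
by rewrite cardfsU dis cardfs0 subn0 cA' mul2n addnn.
Qed.

End Windows.

Theorem theorem5p16 (R : realType) (n r : nat) :
  (3 <= n)%N -> (1 <= r <= maxn 1 (n %/ 4 - 1))%N ->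
  exists2 A : set (BS n), positive_density R A &
    forall g : BS n, A g -> g <> 1%g /\ conj_curvature R r g = 0%R.
Proof.
move=> n3 /andP[r1 rmax].
have n0 : (0 < n)%N by lia.
have rn : (r = 1 \/ 4 * r + 1 <= n)%N by move: rmax; lia.
exists [set g | good r g].
  have [C [K CK]] := sphere_le_good n3 r1 rn.
  (* Less than [1 / C], and less than [1 / 2] since [C >= 1]. *)
  exists ((C + 2)%:R^-1); first by rewrite invr_gt0 ltr0n addn2.
  exists K => // N /= KN; have S0 := card_sphere_gt0 n0 N.
  have := CK N KN; have := good_le_half n3 r1 rn N.
  move: (Defs.card _) (Defs.card _) S0 => a s s0 h1 h2.
  have a0 : (0 < a)%N by lia.
  have C0 : (0 < C)%N by lia.
  apply/andP; split.
    rewrite ltr_pdivlMr ?ltr0n // mulrC ltr_pdivrMr ?ltr0n ?addn2 //.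
    by rewrite -natrM ltr_nat; lia.
  have e3 : ((C + 2)%:R^-1 : R) <= 3%:R^-1.
    by rewrite lef_pV2 ?posrE ?ltr0n ?addn2 // ler_nat; lia.
  have s0' : (0 : R) < s%:R by rewrite ltr0n.
  have as' : 2 * (a%:R : R) <= s%:R by rewrite -natrM ler_nat.
  by rewrite ltr_pdivrMr //; nra.
move=> g gg; split.
  by move=> g1; have := good_height_gt0 gg; rewrite g1 coord1.
have ll p : p \in sphere n r -> word_length (g ^ p)%g = word_length g.
  by move/set_mem => pr; exact: (conj_length n3 r1 rn gg (eq_leq pr)).
have sum : \sum_(p \in sphere n r) ((word_length (g ^ p)%g)%:R : R) =
    (word_length g)%:R * (Defs.card (sphere n r))%:R.
  rewrite fsbig_finite; last exact: sphere_finite.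
  rewrite (eq_big_seq (fun=> (word_length g)%:R)) => [|p]; last first.
    by rewrite in_fset_set; [move/ll-> | exact: sphere_finite].
  by rewrite big_const_seq count_predT iter_addr addr0 mulr_natr.
by rewrite /conj_curvature sum mulfK ?pnatr_eq0 -?lt0n ?(card_sphere_gt0 n0) // subrr mul0r.
Qed.
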